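(* Consider the distributed VIP with operators $f_i=\frac{1}{m_i}\sum_{j=1}^{m_i}F_{i,j}$, $F_{i,j}:\mathbb{R}^{d'}\to\mathbb{R}^{d'}$, $i=1,\dots,n$, and suppose: it attains a unique solution $z^*\in\mathbb{R}^{d'}$; each $f_i$ is $\mu$-quasi-strongly monotone around $z^*$ ($\mu>0$), i.e. $\langle f_i(u)-f_i(z^* ),u-z^*\rangle\ge\mu\|u-z^*\|^2$ for all $u\in\mathbb{R}^{d'}$; and for some $\widehat\ell>0$, for all $i$ and all $u\in\mathbb{R}^{d'}$, $$\frac{1}{m_i}\sum_{j=1}^{m_i}\|F_{i,j}(u)-F_{i,j}(z^* )\|^2\le\widehat\ell\,\langle f_i(u)-f_i(z^* ),u-z^*\rangle.$$ Run ProxSkip-L-SVRGDA-FL with $\gamma=\min\{\frac1\mu,\frac{1}{6\widehat\ell}\}$, $p=\sqrt{\gamma\mu}$, $q=2\gamma\mu$, and, with $M=\frac4q$ and $\sigma_t^2=\sum_{i=1}^n\frac{1}{m_i}\sum_{j=1}^{m_i}\|F_{i,j}(w_{i,t})-F_{i,j}(z^* )\|^2$, let $$V_t:=\sum_{i=1}^n\|x_{i,t}-z^*\|^2+\left(\frac{\gamma}{p}\right)^2\sum_{i=1}^n\|h_{i,t}-f_i(z^* )\|^2+M\gamma^2\sigma_t^2 .$$ Then the iterates achieve $\mathbb{E}[V_T]\le\epsilon$ with iteration complexity $\mathcal{O}\left(\frac{\widehat\ell}{\mu}\ln\frac1\epsilon\right)$ and communication complexity $\mathcal{O}\left(\sq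rt{\frac{\widehat\ell}{\mu}}\,\ln\frac1\epsilon\right)$.
   Context: **Distributed VIP.** Find $z^*\in\mathbb{R}^{d'}$ with $\langle F(z^* ),z-z^*\rangle\ge0$ for all $z\in\mathbb{R}^{d'}$, where $F(z)=\frac1n\sum_{i=1}^nf_i(z)$ (equivalently $F(z^* )=0$). Operator $f_i$ is held by client $i$. **Algorithm ProxSkip-L-SVRGDA-FL.** Input: (non-random) $x_{i,0}\in\mathbb{R}^{d'}$ and $h_{i,0}=0\in\mathbb{R}^{d'}$ for $i=1,\dots,n$, $\gamma>0$, $p,q\in(0,1]$. Set $w_{i,0}=x_{i,0}$. For $t=0,1,2,\dots$: the server draws $\theta_t,\zeta_t\in\{0,1\}$ with $\Pr(\theta_t=1)=p$, $\Pr(\zeta_t=1)=q$. Every client $i$ draws an index $j_t$ uniformly from $\{1,\dots,m_i\}$, sets $g_{i,t}=F_{i,j_t}(x_{i,t})-F_{i,j_t}(w_{i,t})+f_i(w_{i,t})$, sets $w_{i,t+1}=x_{i,t}$ if $\zeta_t=1$ and $w_{i,t+1}=w_{i,t}$ otherwise, and sets $\hat x_{i,t+1}=x_{i,t}-\gamma(g_{i,t}-h_{i,t})$. If $\theta_t=1$ (a communication round), each client sends $x_{i,t+1}'=\hat x_{i,t+1}-\frac{\gamma}{p}h_{i,t}$ and all clients receive $x_{i,t+1}=\frac1n\sum_{k=1}^nx_{k,t+1}'$; if $\theta_t=0$, $x_{i,t+1}=\hat x_{i,t+1}$. Then $h_{i,t+1}=h_{i,t}+\frac{p}{\gamma}(x_{i,t+1}-\hat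 x_{i,t+1})$. All random draws are independent. **Complexity conventions.** Iteration complexity $\mathcal{O}(N\ln\frac1\epsilon)$ means: $\mathbb{E}[V_T]\le\epsilon$ for some $T\le cN\ln\frac{V_0}{\epsilon}$, with $c$ a universal numerical constant, for $0<\epsilon\le V_0/2$ (the dependence on $V_0$ inside the logarithm is suppressed). Communication complexity is the expected number $pT$ of communication rounds for this $T$. *)

(* Defs.v *)
From mathcomp Require Export all_boot all_order all_algebra.
From mathcomp Require Export all_classical all_reals all_analysis.

Set Implicit Arguments.
Unset Strict Implicit.
Unset Printing Implicit Defensive.

Export Order.TTheory GRing.Theory Num.Theory.
Export numFieldNormedType.Exports.

#[global] Open Scope classical_set_scope.
#[global] Open Scope ring_scope.

(* The norm that the library puts on 'rV[R]_d is the sup norm, so the Euclidean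
   structure is defined here. *)
Section Euclidean.
Context {R : realType} {d : nat}.

Definition dotV (u v : 'rV[R]_d) : R := \sum_(k < d) u 0 k * v 0 k.

Definition l2norm (u : 'rV[R]_d) : R := Num.sqrt (dotV u u).

End Euclidean.

Section Problem.
Context {R : realType} {d n : nat} {m : 'I_n -> nat}.

(* F i j is the j-th component of the operator held by client i. *)
Variable F : forall i : 'I_n, 'I_(m i) -> 'rV[R]_d -> 'rV[R]_d.

Definition client_op (i : 'I_n) (u : 'rV[R]_d) : 'rV[R]_d :=
  (m i)%:R^-1 *: \sum_(j < m i) F j u.

Definition global_op (u : 'rV[R]_d) : 'rV[R]_d :=
  n%:R^-1 *: \sum_(i < n) client_op i u.

Definition vip_solution (G : 'rV[R]_d -> 'rV[R]_d) (z : 'rV[R]_d) : Prop :=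
  forall u, 0 <= dotV (G z) (u - z).

Definition quasi_strongly_monotone (mu : R) (z : 'rV[R]_d)
    (G : 'rV[R]_d -> 'rV[R]_d) : Prop :=
  forall u, dotV (G u - G z) (u - z) >= mu * l2norm (u - z) ^+ 2.

Definition mean_sq_dev (z : 'rV[R]_d) (i : 'I_n) (u : 'rV[R]_d) : R :=
  (m i)%:R^-1 * \sum_(j < m i) l2norm (F j u - F j z) ^+ 2.

Definition averaged_star_cocoercive (ell : R) (z : 'rV[R]_d) : Prop :=
  forall i u,
    mean_sq_dev z i u <= ell * dotV (client_op i u - client_op i z) (u - z).

End Problem.

Section Algorithm.
Context {R : realType} {d n : nat} {m : 'I_n -> nat}.
Variable F : forall i : 'I_n, 'I_(m i) -> 'rV[R]_d -> 'rV[R]_d.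
Variables gamma p : R.

Record state := State {
  iterate : 'I_n -> 'rV[R]_d;    (* x_i *)
  control : 'I_n -> 'rV[R]_d;    (* h_i *)
  reference : 'I_n -> 'rV[R]_d   (* w_i *)
}.

Definition init (x0 : 'I_n -> 'rV[R]_d) : state := State x0 (fun=> 0) x0.

Definition step (theta zeta : bool) (j : forall i, 'I_(m i)) (s : state) :
    state :=
  let x := iterate s in
  let h := control s in
  let w := reference s in
  let g i := F (j i) (x i) - F (j i) (w i) + client_op F i (w i) in
  let xhat i := x i - gamma *: (g i - h i) in
  let x' i := xhat i - (gamma / p) *: h i in
  let xnew i := if theta then n%:R^-1 *: \sum_(k < n) x' k else xhat i in
  let wnew i := if zeta then x i else w i in
  let hnew i := h i + (p / gamma) *: (xnew i - xhat i) in
  State xnew hnew wnew.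

Fixpoint run (theta zeta : nat -> bool) (j : forall i, nat -> 'I_(m i))
    (x0 : 'I_n -> 'rV[R]_d) (t : nat) : state :=
  if t is t'.+1 then
    step (theta t') (zeta t') (fun i => j i t') (run theta zeta j x0 t')
  else init x0.

Definition lyapunov (q : R) (z : 'rV[R]_d) (s : state) : R :=
  let M := 4 / q in
  let sigma2 := \sum_(i < n) mean_sq_dev F z i (reference s i) in
  \sum_(i < n) l2norm (iterate s i - z) ^+ 2
  + (gamma / p) ^+ 2
    * \sum_(i < n) l2norm (control s i - client_op F i z) ^+ 2
  + M * gamma ^+ 2 * sigma2.

End Algorithm.

(* Mutual independence of a family of systems of events: the product rule holds
   for every finite subfamily, enumerated without repetition by s. *)
Definition mutually_independent {R : realType} {disp : measure_display}
    {Omega : measurableType disp} (P : probability Omega R) (K : Type)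
    (E : K -> set (set Omega)) : Prop :=
  forall (r : nat) (s : 'I_r -> K), injective s ->
  forall A : 'I_r -> set Omega, (forall l, E (s l) (A l)) ->
  P (\bigcap_l A l) = (\prod_(l < r) P (A l))%E.

Section Draws.
Context {R : realType} {disp : measure_display} {Omega : measurableType disp}.
Variable P : probability Omega R.
Context {n : nat} {m : 'I_n -> nat}.
Variables theta zeta : nat -> {RV P >-> bool}.
(* 'I_(m i), which may be empty, is not a measurableType of the library (these
   are pointed): its discrete sigma-algebra is spelled out below. *)
Variable j : forall i : 'I_n, nat -> Omega -> 'I_(m i).

Inductive draw_index : Type :=
| ThetaDraw of nat
| ZetaDraw of nat
| SampleDraw of 'I_n & nat.

Definition draw_events (k : draw_index) : set (set Omega) :=
  match k with
  | ThetaDraw t => preimage_set_system setT (theta t) measurable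
  | ZetaDraw t => preimage_set_system setT (zeta t) measurable
  | SampleDraw i t => preimage_set_system setT (j i t) discrete_measurable
  end.

Definition algorithm_draws (p q : R) : Prop :=
  [/\ forall i t B, measurable (j i t @^-1` B),
      forall t, P (theta t @^-1` [set true]) = p%:E,
      forall t, P (zeta t @^-1` [set true]) = q%:E,
      forall i t k, P (j i t @^-1` [set k]) = ((m i)%:R^-1)%:E
    & mutually_independent P draw_events].

Definition comm_rounds (T : nat) (omega : Omega) : R :=
  \sum_(t < T) (theta t omega)%:R.

End Draws.

(* Main.v *)
Require Import Defs.
From mathcomp Require Import measurable_realfun ring lra.

(** Everything rests on the one-step estimate
      E[V_(t+1) | state at time t] <= (1 - gamma mu) V_t,
    whose proof averages the three kinds of coins of a round one after the
    other.

    Communication coin.  A communication round sends the vector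
    a_i = (xhat_i - z) - (gamma / p) (h_i - f_i(z)) of each client to the mean
    of these vectors, and turns the control error into (p / gamma) times the
    deviation from that mean; this uses that the f_i(z) sum to zero, i.e. that
    z solves the problem.  By Pythagoras the energy
    sum |x_i - z|^2 + (gamma/p)^2 sum |h_i - f_i(z)|^2 is then sum |a_i|^2.
    Averaging this with the silent round, the cross terms cancel exactly, and
    the energy splits into independent contributions of the clients
    ([energy_coin_mean]): a plain stochastic gradient step towards z, and the
    old control error multiplied by 1 - p^2.

    Sampling.  The variance-reduced estimator g_i is unbiased, and
    E|g_i - f_i(z)|^2 is at most twice the mean square deviation at x_i plus
    twice the one at w_i ([svrg_second_moment]).  With quasi-strong
    monotonicity and averaged star-cocoercivity the gradient step contracts, up
    to an error governed by the deviation at w_i ([client_contraction]).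

    Reference coin.  The term M gamma^2 sigma^2 of V pays for that error: it
    decreases by the factor 1 - q in expectation, and what the refreshed
    references bring in is absorbed because 6 ell gamma <= 1.  The choices
    p^2 = gamma mu, q = 2 gamma mu, M = 4 / q make all three parts contract at
    the same rate ([lyapunov_contraction]).

    A run of length T depends on finitely many discrete draws only, so it is a
    function of a history ranging over a finite type; independence says that
    the law of the history is a product of weights ([history_law]).  Hence
    E[V_T] is a finite weighted sum, and the one-step estimate iterates over
    it ([lyapunov_run_draws]).

    Finally mu <= ell, so gamma mu = 1 / (6 kappa) with kappa = ell / mu >= 1,
    and the first integer above 6 kappa ln(V_0 / eps) serves as T
    ([iteration_count]); p = 1 / sqrt(6 kappa) turns the factor kappa into
    sqrt(kappa) for the number of communications. *)

Set Implicit Arguments.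
Unset Strict Implicit.
Unset Printing Implicit Defensive.

(** * Euclidean algebra *)

Section EuclideanAlgebra.
Context {R : realType} {d : nat}.
Implicit Types (u v w : 'rV[R]_d) (a : R).

Lemma dotVC u v : dotV u v = dotV v u.
Proof. by apply: eq_bigr => k _; rewrite mulrC. Qed.

Lemma dotVDl u v w : dotV (u + v) w = dotV u w + dotV v w.
Proof. by rewrite -big_split; apply: eq_bigr => k _; rewrite mxE mulrDl. Qed.

Lemma dotVZl a u v : dotV (a *: u) v = a * dotV u v.
Proof. by rewrite mulr_sumr; apply: eq_bigr => k _; rewrite mxE mulrA. Qed.

Lemma dotVNl u v : dotV (- u) v = - dotV u v.
Proof. by rewrite -scaleN1r dotVZl mulN1r. Qed.

Lemma dotVDr u v w : dotV w (u + v) = dotV w u + dotV w v.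
Proof. by rewrite !(dotVC w) dotVDl. Qed.

Lemma dotVZr a u v : dotV u (a *: v) = a * dotV u v.
Proof. by rewrite !(dotVC u) dotVZl. Qed.

Lemma dotVNr u v : dotV u (- v) = - dotV u v.
Proof. by rewrite !(dotVC u) dotVNl. Qed.

Lemma dotV0l v : dotV 0 v = 0.
Proof. by rewrite -(scale0r 0) dotVZl mul0r. Qed.

Lemma dotV_suml (I : Type) (r : seq I) (f : I -> 'rV[R]_d) v :
  dotV (\sum_(i <- r) f i) v = \sum_(i <- r) dotV (f i) v.
Proof.
by elim/big_ind2: _ => [|x ? y ? <- <-|//]; rewrite ?dotV0l ?dotVDl.
Qed.

Definition dotV_bilinE := (dotVDl, dotVDr, dotVNl, dotVNr, dotVZl, dotVZr).

Lemma dotV_ge0 u : 0 <= dotV u u.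
Proof. by apply: sumr_ge0 => k _; rewrite -expr2 sqr_ge0. Qed.

Lemma dotV_le0 u : dotV u u <= 0 -> u = 0.
Proof.
move=> u0; have /eqP : dotV u u = 0 by apply/eqP; rewrite eq_le u0 dotV_ge0.
rewrite psumr_eq0 => [/allP uk0|k _]; last by rewrite -expr2 sqr_ge0.
apply/rowP => k; rewrite mxE; apply/eqP.
have /(_ k) := uk0; rewrite mem_index_enum => /(_ isT).
by rewrite /= -expr2 sqrf_eq0.
Qed.

Lemma sqr_l2norm u : l2norm u ^+ 2 = dotV u u.
Proof. by rewrite sqr_sqrtr// dotV_ge0. Qed.

Lemma dotV_sqB u v :
  dotV (u - v) (u - v) = dotV u u - 2 * dotV u v + dotV v v.
Proof. by rewrite !dotV_bilinE (dotVC v u); ring. Qed.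

Lemma dotV_sqD_le u v : dotV (u + v) (u + v) <= 2 * dotV u u + 2 * dotV v v.
Proof.
have := dotV_ge0 (u - v); rewrite !dotV_bilinE (dotVC v u) => H; lra.
Qed.

(** The Pythagorean identity behind both the variance bound of the estimator
    and the analysis of the communication step. *)
Lemma sum_sq_dev_mean k (a : 'I_k -> 'rV[R]_d) : (0 < k)%N ->
  let abar := k%:R^-1 *: \sum_(l < k) a l in
  \sum_(l < k) dotV (a l - abar) (a l - abar)
  = \sum_(l < k) dotV (a l) (a l) - k%:R * dotV abar abar.
Proof.
move=> k0 abar.
have k0' : k%:R != 0 :> R by rewrite pnatr_eq0 -lt0n.
have Ea : \sum_(l < k) dotV (a l) abar = k%:R * dotV abar abar.
  by rewrite -dotV_suml /abar !dotV_bilinE; field.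
under eq_bigr do rewrite dotV_sqB.
rewrite !big_split/= sumrN -mulr_sumr Ea sumr_const card_ord -[_ *+ k]mulr_natl.
by ring.
Qed.

End EuclideanAlgebra.

(** * The variance-reduced estimator of one client *)

Section Client.
Context {R : realType} {d n : nat} {m : 'I_n -> nat}.
Variable F : forall i : 'I_n, 'I_(m i) -> 'rV[R]_d -> 'rV[R]_d.
Variables (z : 'rV[R]_d) (ell mu : R).
Hypothesis m_gt0 : forall i, (0 < m i)%N.

Local Notation gap i u := (dotV (client_op F i u - client_op F i z) (u - z)).

Lemma mean_sq_dev_ge0 i u : 0 <= mean_sq_dev F z i u.
Proof.
by rewrite mulr_ge0 ?invr_ge0 ?ler0n// sumr_ge0// => k _; rewrite sqr_ge0.
Qed.

Lemma client_opB_mean i u v :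
  client_op F i u - client_op F i v
  = (m i)%:R^-1 *: \sum_(k < m i) (F k u - F k v).
Proof. by rewrite -scalerBr -sumrB. Qed.

(** Jensen: the square of a mean is at most the mean of the squares. *)
Lemma client_sq_le_mean_sq_dev i u :
  dotV (client_op F i u - client_op F i z) (client_op F i u - client_op F i z)
  <= mean_sq_dev F z i u.
Proof.
have m0 : 0 < (m i)%:R :> R by rewrite ltr0n.
rewrite client_opB_mean /mean_sq_dev -(ler_pM2l m0) mulVKf ?gt_eqF//.
under [leRHS]eq_bigr do rewrite sqr_l2norm.
rewrite -subr_ge0 -sum_sq_dev_mean//.
by apply: sumr_ge0 => k _; exact: dotV_ge0.
Qed.

(** Cocoercivity makes the client operator ell-Lipschitz at z, which is
    compatible with mu-monotonicity only if the condition number is at least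
    one; a point other than z is needed to see it. *)
Lemma mu_le_ell i u : 0 < mu -> 0 < ell ->
  quasi_strongly_monotone mu z (client_op F i) ->
  averaged_star_cocoercive F ell z -> u != z -> mu <= ell.
Proof.
move=> mu0 ell0 /(_ u) + /(_ i u) + uz.
rewrite sqr_l2norm; set D := client_op F i u - _; set e := u - z => qsm coc.
have e0 : 0 < dotV e e.
  rewrite lt_neqAle dotV_ge0 andbT eq_sym; apply: contra uz => /eqP e0.
  by rewrite -subr_eq0; apply/eqP/dotV_le0; rewrite -/e e0.
have DD : dotV D D <= ell * dotV D e.
  exact: le_trans (client_sq_le_mean_sq_dev i u) coc.
(* |D - ell e|^2 >= 0 plays the part of Cauchy-Schwarz and Young together *)
have := dotV_ge0 (D - ell *: e).
rewrite dotV_sqB dotVZl !dotVZr => sq.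
have H : ell * dotV D e <= ell * (ell * dotV e e) by lra.
rewrite ler_pM2l// in H.
by rewrite -(ler_pM2r e0); apply: le_trans qsm _.
Qed.

Definition svrg i (x w : 'rV[R]_d) (k : 'I_(m i)) : 'rV[R]_d :=
  F k x - F k w + client_op F i w.

Lemma svrg_unbiased i x w :
  (m i)%:R^-1 *: \sum_(k < m i) (svrg x w k - client_op F i z)
  = client_op F i x - client_op F i z.
Proof.
have m0 : (m i)%:R != 0 :> R by rewrite pnatr_eq0 -lt0n.
have mean_cst (c : 'rV[R]_d) : (m i)%:R^-1 *: \sum_(k < m i) c = c.
  by rewrite sumr_const card_ord -[c *+ _]scaler_nat scalerA mulVf// scale1r.
rewrite sumrB scalerBr mean_cst; congr (_ - _).
by rewrite big_split/= scalerDr mean_cst sumrB scalerBr subrK.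
Qed.

(** The estimator minus f_i(z) is the fluctuation of the sample at x minus the
    centred fluctuation at w; centring can only decrease the second moment. *)
Lemma svrg_second_moment i x w :
  (m i)%:R^-1 * \sum_(k < m i) dotV (svrg x w k - client_op F i z)
                                    (svrg x w k - client_op F i z)
  <= 2 * mean_sq_dev F z i x + 2 * mean_sq_dev F z i w.
Proof.
have m0 : 0 < (m i)%:R :> R by rewrite ltr0n.
rewrite /mean_sq_dev mulrCA [2 * (_ * _)]mulrCA -mulrDr ler_pM2l ?invr_gt0//.
under [X in 2 * X + _]eq_bigr do rewrite sqr_l2norm.
under [X in _ + 2 * X]eq_bigr do rewrite sqr_l2norm.
pose b (k : 'I_(m i)) := F k w - F k z.
pose bbar := (m i)%:R^-1 *: \sum_(k < m i) b k.
have -> : \sum_(k < m i) dotV (svrg x w k - client_op F i z)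
                              (svrg x w k - client_op F i z) =
  \sum_(k < m i) dotV ((F k x - F k z) + - (b k - bbar))
                      ((F k x - F k z) + - (b k - bbar)).
  apply: eq_bigr => k _.
  suff -> : svrg x w k - client_op F i z = F k x - F k z + - (b k - bbar) by [].
  rewrite /bbar -client_opB_mean /svrg /b.
  by apply/rowP => c; rewrite !mxE; ring.
apply: le_trans (ler_sum _ (fun k _ => dotV_sqD_le _ _)) _.
rewrite big_split/= -!mulr_sumr lerD2l ler_pM2l//.
under [leLHS]eq_bigr do rewrite dotVNl dotVNr opprK.
rewrite sum_sq_dev_mean// gerBl mulr_ge0 ?ler0n//; exact: dotV_ge0.
Qed.

(** Expanding the square, the cross term brings in -2 gamma G with
    G = <f_i(x) - f_i(z), x - z>.  The deviation at x is charged
    6 gamma^2 in total, where 2 comes from the second moment and 4 is the share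
    M q that a refreshed reference costs; by cocoercivity and
    6 ell gamma <= 1 this uses up gamma G, and the remaining gamma G gives the
    factor 1 - gamma mu. *)
Lemma client_contraction (gamma : R) i x w :
  0 < mu -> 0 < gamma -> 6 * ell * gamma <= 1 ->
  quasi_strongly_monotone mu z (client_op F i) ->
  averaged_star_cocoercive F ell z ->
  (m i)%:R^-1 * \sum_(k < m i)
     dotV (x - z - gamma *: (svrg x w k - client_op F i z))
          (x - z - gamma *: (svrg x w k - client_op F i z))
  + 4 * gamma ^+ 2 * mean_sq_dev F z i x
  <= (1 - gamma * mu) * dotV (x - z) (x - z)
     + 2 * gamma ^+ 2 * mean_sq_dev F z i w.
Proof.
move=> mu0 gamma0 gl /(_ x) + /(_ i x); rewrite sqr_l2norm => qsm coc.
have m0 : (m i)%:R != 0 :> R by rewrite pnatr_eq0 -lt0n.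
have -> : (m i)%:R^-1 * \sum_(k < m i)
     dotV (x - z - gamma *: (svrg x w k - client_op F i z))
          (x - z - gamma *: (svrg x w k - client_op F i z)) =
   dotV (x - z) (x - z) - 2 * gamma * gap i x
   + gamma ^+ 2 * ((m i)%:R^-1 *
      \sum_(k < m i) dotV (svrg x w k - client_op F i z)
                          (svrg x w k - client_op F i z)).
  rewrite -(svrg_unbiased i x w) dotVZl dotV_suml.
  have E (e a : 'rV[R]_d) : dotV (e - gamma *: a) (e - gamma *: a) =
      dotV e e - 2 * gamma * dotV a e + gamma ^+ 2 * dotV a a.
    by rewrite dotV_sqB dotVZl !dotVZr (dotVC e a); ring.
  under eq_bigr do rewrite E.
  rewrite !big_split/= sumrN -!mulr_sumr sumr_const card_ord
    -[_ *+ m i]mulr_natl.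
  by field.
have := @svrg_second_moment i x w.
set S := (_ * \sum_(_ < _) _); set A := mean_sq_dev _ _ _ x.
set B := mean_sq_dev _ _ _ w; set G := gap i x in qsm coc *.
set e2 := dotV (x - z) (x - z) in qsm * => HS.
have e20 : 0 <= e2 by exact: dotV_ge0.
have H1 : gamma ^+ 2 * S <= gamma ^+ 2 * (2 * A + 2 * B).
  by apply: ler_wpM2l => //; exact: sqr_ge0.
have H2 : gamma ^+ 2 * A <= gamma ^+ 2 * (ell * G).
  by apply: ler_wpM2l => //; exact: sqr_ge0.
have A0 : 0 <= A by exact: mean_sq_dev_ge0.
have G0 : 0 <= G by rewrite (le_trans _ qsm)// mulr_ge0// ltW.
have H3 : gamma * (mu * e2) <= gamma * G by rewrite ler_pM2l.
have H4 : 0 <= (1 - 6 * ell * gamma) * (gamma * G).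
  by rewrite mulr_ge0 ?subr_ge0// mulr_ge0// ltW.
lra.
Qed.

End Client.

(** * Averaging over the communication coin *)

(** Test the inequality at z - G(z). *)
Lemma vip_solution_zero {R : realType} {d : nat} (G : 'rV[R]_d -> 'rV[R]_d) z :
  vip_solution G z -> G z = 0.
Proof.
move=> /(_ (z - G z)); rewrite addrAC subrr add0r dotVNr oppr_ge0.
exact: dotV_le0.
Qed.

Section RandomStep.
Context {R : realType} {d n : nat} {m : 'I_n -> nat}.
Variable F : forall i : 'I_n, 'I_(m i) -> 'rV[R]_d -> 'rV[R]_d.
Variables (z : 'rV[R]_d) (gamma p : R).
Hypotheses (n_gt0 : (0 < n)%N) (m_gt0 : forall i, (0 < m i)%N).
Hypotheses (gamma_neq0 : gamma != 0) (p_neq0 : p != 0).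
Hypothesis z_sol : global_op F z = 0.

Local Notation f_ i := (client_op F i z).
Local Notation sq u := (dotV u u).

Lemma sum_client_op_sol : \sum_(i < n) f_ i = 0.
Proof.
have n0 : n%:R^-1 != 0 :> R by rewrite invr_eq0 pnatr_eq0 -lt0n.
by have /eqP := z_sol; rewrite scaler_eq0 (negbTE n0) => /eqP.
Qed.

(** The error after a stochastic step whose estimator is corrected by the exact
    value f_i(z) instead of the current control variate. *)
Definition residual (s : state) (i : 'I_n) (k : 'I_(m i)) : 'rV[R]_d :=
  iterate s i - z - gamma *: (svrg F (iterate s i) (reference s i) k - f_ i).

Section FixedSamples.
Variables (s : @state R d n) (j : forall i, 'I_(m i)).
Local Notation B i := (control s i - f_ i).
Local Notation A i := (residual s (j i) + gamma *: B i).

Definition iterate_control_energy (s' : @state R d n) : R :=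
  \sum_(i < n) sq (iterate s' i - z)
  + (gamma / p) ^+ 2 * \sum_(i < n) sq (control s' i - f_ i).

Lemma energy_silent zeta :
  iterate_control_energy (step F gamma p false zeta j s)
  = \sum_(i < n) (sq (A i) + (gamma / p) ^+ 2 * sq (B i)).
Proof.
rewrite big_split/= -mulr_sumr; congr (_ + _ * _); apply: eq_bigr => i _ /=.
  set u := (X in sq X); suff -> : u = A i by [].
  by rewrite /u /residual /svrg; apply/rowP => c; rewrite !mxE; ring.
by rewrite subrr scaler0 addr0.
Qed.

(** The new errors are the mean of the vectors a_i and, up to the factor
    p / gamma, the deviations from that mean; Pythagoras adds their squares up
    to sum |a_i|^2. *)
Lemma energy_communication zeta :
  iterate_control_energy (step F gamma p true zeta j s)
  = \sum_(i < n) sq (A i - (gamma / p) *: B i).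
Proof.
pose a i := A i - (gamma / p) *: B i.
pose abar := n%:R^-1 *: \sum_(i < n) a i.
have n0 : n%:R != 0 :> R by rewrite pnatr_eq0 -lt0n.
pose s' := step F gamma p true zeta j s.
have Ex i : iterate s' i - z = abar.
  rewrite /abar /=.
  (* each a k is the message of client k, shifted by z and by its f_ k *)
  have -> : \sum_(k < n) a k = \sum_(k < n)
     (iterate s k - gamma *: (F (j k) (iterate s k) - F (j k) (reference s k)
        + client_op F k (reference s k) - control s k)
      - (gamma / p) *: control s k) - z *+ n + (gamma / p) *: \sum_(k < n) f_ k.
    rewrite scaler_sumr -[z *+ n](_ : \sum_(k < n) z = _); last first.
      by rewrite sumr_const card_ord.
    rewrite -sumrB -big_split; apply: eq_bigr => k _.
    by rewrite /a /residual /svrg; apply/rowP => c; rewrite !mxE; ring.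
  rewrite sum_client_op_sol scaler0 addr0 scalerBr; congr (_ - _).
  by rewrite -[z *+ n]scaler_nat scalerA mulVf// scale1r.
have Eh i : control s' i - f_ i = (p / gamma) *: (abar - a i).
  rewrite -(Ex i) /=; set xn := n%:R^-1 *: _.
  rewrite /a /residual /svrg; apply/rowP => c; rewrite !mxE; field.
  by rewrite pnatr_eq0 -lt0n m_gt0 p_neq0 n0.
rewrite /iterate_control_energy -/s'.
under eq_bigr do rewrite Ex.
under [X in _ + _ * X]eq_bigr do
  rewrite Eh -opprB scalerN dotVNl dotVNr opprK dotVZl dotVZr.
rewrite -!mulr_sumr (sum_sq_dev_mean a n_gt0) -/abar sumr_const card_ord.
rewrite -mulr_natl.
by field; apply/andP.
Qed.

(** With A = residual + gamma B, the cross terms of |A - (gamma/p) B|^2 and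
    |A|^2 cancel in the mean; the -gamma^2 |B|^2 which remains of them is
    -p^2 times the control term. *)
Lemma energy_coin_mean zeta :
  p * iterate_control_energy (step F gamma p true zeta j s)
  + (1 - p) * iterate_control_energy (step F gamma p false zeta j s)
  = \sum_(i < n) (sq (residual s (j i))
                  + (1 - p ^+ 2) * ((gamma / p) ^+ 2 * sq (B i))).
Proof.
rewrite energy_communication energy_silent !mulr_sumr -big_split/=.
apply: eq_bigr => i _.
move: (residual s (j i)) (B i) => c b.
rewrite dotV_sqB !dotV_bilinE (dotVC b c).
by field.
Qed.

End FixedSamples.
End RandomStep.

(** * Finite averages over the draws of a round *)

Lemma sum_fprod_prod {R : comNzRingType} {I : finType} {T_ : I -> finType}
    (P : forall i, T_ i -> R) :
  \sum_(t : fprod T_) \prod_i P i (t i) = \prod_i \sum_k P i k.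
Proof.
pose Q i := [ffun k => P i k].
transitivity (\sum_(t : fprod T_) \prod_(i in I) Q i (t i)).
  by apply: eq_bigr => t _; apply: eq_bigr => i _; rewrite ffunE.
rewrite (big_fprod 1 _ Q) -(bigA_distr_big_dep _ (fun i g => untag 0 (Q i) g)).
apply: eq_bigr => i _; rewrite -(big_tag (fun i => Q i)).
by apply: eq_bigr => k _; rewrite ffunE.
Qed.

Lemma tuple_sum_recl (R : nmodType) (A : finType) (T : nat)
    (phi : T.+1.-tuple A -> R) :
  \sum_h phi h = \sum_x \sum_(h : T.-tuple A) phi [tuple of x :: h].
Proof.
pose consT (xh : A * T.-tuple A) := [tuple of xh.1 :: xh.2].
rewrite pair_bigA/= (reindex consT) => [//|].
exists (fun h : T.+1.-tuple A => (thead h, [tuple of behead h])).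
  move=> [x h] _.
  by rewrite /consT theadE; congr pair; apply: val_inj.
by move=> h _; rewrite [RHS]tuple_eta.
Qed.

Section Draw.
Context {R : realType} {n : nat}.
Variable m : 'I_n -> nat.

Definition draw : finType := (bool * bool * fprod (fun i => 'I_(m i)))%type.

Definition bernoulli_weight (p : R) (b : bool) : R := if b then p else 1 - p.

Definition sample_weight : R := \prod_(i < n) (m i)%:R^-1.

Definition draw_weight (p q : R) (x : draw) : R :=
  bernoulli_weight p x.1.1 * bernoulli_weight q x.1.2 * sample_weight.

Lemma sum_draw p q (phi : draw -> R) :
  \sum_x draw_weight p q x * phi x
  = \sum_j sample_weight *
      (p * (q * phi (true, true, j) + (1 - q) * phi (true, false, j))
       + (1 - p) * (q * phi (false, true, j) + (1 - q) * phi (false, false, j))).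
Proof.
transitivity (\sum_ab \sum_j draw_weight p q (ab, j) * phi (ab, j)).
  by rewrite pair_bigA; apply: eq_bigr => -[].
rewrite exchange_big/=; apply: eq_bigr => j _.
transitivity (\sum_a \sum_b draw_weight p q (a, b, j) * phi (a, b, j)).
  by rewrite pair_bigA; apply: eq_bigr => -[].
rewrite !big_bool.
by rewrite /draw_weight/=; ring.
Qed.

Hypothesis m_gt0 : forall i, (0 < m i)%N.

(** A sum over clients only sees the marginals of the joint sample: the factors
    of the other clients sum to one. *)
Lemma sample_mean (G : forall i, 'I_(m i) -> R) :
  \sum_(j : fprod (fun i => 'I_(m i))) sample_weight * \sum_(i < n) G i (j i)
  = \sum_(i < n) (m i)%:R^-1 * \sum_(k < m i) G i k.
Proof.
under eq_bigr do rewrite mulr_sumr.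
rewrite exchange_big/=; apply: eq_bigr => i _.
pose P i' (k : 'I_(m i')) := (m i')%:R^-1 * (if i' == i then G i' k else 1).
transitivity (\sum_(j : fprod (fun i => 'I_(m i))) \prod_i' P i' (j i')).
  apply: eq_bigr => j _; rewrite /P big_split/=; congr (_ * _).
  by rewrite -big_mkcond/= big_pred1_eq.
rewrite sum_fprod_prod (bigD1 i)//= [X in _ * X]big1 => [|i' i'i]; last first.
  rewrite /P (negbTE i'i) -mulr_sumr sumr_const card_ord mulVf//.
  by rewrite pnatr_eq0 -lt0n.
by rewrite mulr1 mulr_sumr; apply: eq_bigr => k _; rewrite /P eqxx.
Qed.

End Draw.

(** * Contraction of the Lyapunov function *)

Section Contraction.
Context {R : realType} {d n : nat} {m : 'I_n -> nat}.
Variable F : forall i : 'I_n, 'I_(m i) -> 'rV[R]_d -> 'rV[R]_d.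
Variables (z : 'rV[R]_d) (mu ell gamma p q : R).
Hypotheses (n_gt0 : (0 < n)%N) (m_gt0 : forall i, (0 < m i)%N).
Hypothesis z_sol : global_op F z = 0.
Hypotheses (mu_gt0 : 0 < mu) (gamma_gt0 : 0 < gamma) (p_gt0 : 0 < p).
Hypothesis qsm : forall i, quasi_strongly_monotone mu z (client_op F i).
Hypothesis coc : averaged_star_cocoercive F ell z.
Hypotheses (gamma_ell : 6 * ell * gamma <= 1).
Hypotheses (p_def : p ^+ 2 = gamma * mu) (q_def : q = 2 * gamma * mu).
Hypothesis q_le1 : q <= 1.

Local Notation V := (lyapunov F gamma p q z).

Definition draw_step (s : state) (x : draw m) : state :=
  step F gamma p x.1.1 x.1.2 x.2 s.

Lemma lyapunov_coins_mean s (j : forall i, 'I_(m i)) :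
  p * (q * V (step F gamma p true true j s)
       + (1 - q) * V (step F gamma p true false j s))
  + (1 - p) * (q * V (step F gamma p false true j s)
               + (1 - q) * V (step F gamma p false false j s))
  = \sum_(i < n)
      (dotV (residual F z gamma s (j i)) (residual F z gamma s (j i))
       + (1 - p ^+ 2) * ((gamma / p) ^+ 2 *
           dotV (control s i - client_op F i z) (control s i - client_op F i z))
       + 4 / q * gamma ^+ 2 *
           (q * mean_sq_dev F z i (iterate s i)
            + (1 - q) * mean_sq_dev F z i (reference s i))).
Proof.
have VE theta zeta : V (step F gamma p theta zeta j s) =
    iterate_control_energy F z gamma p (step F gamma p theta true j s)
    + 4 / q * gamma ^+ 2 * \sum_(i < n) mean_sq_dev F z i
        (if zeta then iterate s i else reference s i).
  congr (_ + _ * _ + _); apply: eq_bigr => i _; exact: sqr_l2norm.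
rewrite !VE big_split/= -(energy_coin_mean _ _ _ _ _ _ _ true)//;
  try exact: lt0r_neq0.
rewrite -mulr_sumr big_split/= -!mulr_sumr.
by ring.
Qed.

(** Since M q = 4, the control term contracts exactly by 1 - p^2 and the
    deviation term changes by -4 gamma^2 plus the 2 gamma^2 from
    [client_contraction]; as -2 gamma^2 = - (q / 2) M gamma^2, its factor is
    1 - q / 2.  Both factors equal 1 - gamma mu. *)
Lemma lyapunov_contraction s :
  \sum_x draw_weight p q x * V (draw_step s x)
  <= (1 - gamma * mu) * V s.
Proof.
rewrite sum_draw; under eq_bigr do rewrite lyapunov_coins_mean.
rewrite (sample_mean m_gt0 (fun i k =>
  dotV (residual F z gamma s k) (residual F z gamma s k) + _ + _))/=.
rewrite /lyapunov.
under [X in _ * (X + _ + _)]eq_bigr do rewrite sqr_l2norm.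
under [X in _ * (_ + _ * X + _)]eq_bigr do rewrite sqr_l2norm.
rewrite !mulr_sumr -!big_split/= mulr_sumr; apply: ler_sum => i _.
have m0 : (m i)%:R != 0 :> R by rewrite pnatr_eq0 -lt0n.
have gm0 : 0 < gamma * mu by rewrite mulr_gt0.
have := client_contraction m_gt0 (iterate s i) (reference s i)
  mu_gt0 gamma_gt0 gamma_ell (qsm i) coc.
have q_neq0 : q != 0 by rewrite q_def -mulrA lt0r_neq0// mulr_gt0.
rewrite big_split/= big_split/= !sumr_const card_ord.
set S := \sum_(k < _) _; set C := (_ * dotV (control _ _ - _) _).
set A := mean_sq_dev _ _ _ (iterate _ _); set B := mean_sq_dev _ _ _ _.
set e := dotV (_ - z) _ => client.
have -> (X Y : R) :
    (m i)%:R^-1 * (S + X *+ m i + Y *+ m i) = (m i)%:R^-1 * S + X + Y.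
  by rewrite -[X *+ _]mulr_natl -[Y *+ _]mulr_natl; field.
have -> : 4 / q * gamma ^+ 2 * (q * A + (1 - q) * B) =
    4 * gamma ^+ 2 * A + 4 / q * gamma ^+ 2 * B - 4 * gamma ^+ 2 * B by field.
have -> : (1 - gamma * mu) * (e + C + 4 / q * gamma ^+ 2 * B) =
    (1 - gamma * mu) * e + (1 - gamma * mu) * C + 4 / q * gamma ^+ 2 * B
    - 2 * gamma ^+ 2 * B.
  have -> : gamma * mu = q / 2 by rewrite q_def; field.
  by field.
rewrite p_def; lra.
Qed.

Definition run_draws (s : @state R d n) (xs : seq (draw m)) : state :=
  foldl draw_step s xs.

Lemma rate_le1 : gamma * mu <= 1.
Proof.
have := mulr_gt0 gamma_gt0 mu_gt0.
by have := q_le1; rewrite q_def; lra.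
Qed.

Lemma draw_weight_ge0 (x : draw m) : 0 <= draw_weight p q x.
Proof.
have p1 : p <= 1.
  by rewrite -(@expr_le1 _ 2) ?(ltW p_gt0)// p_def; exact: rate_le1.
have q0 : 0 <= q by rewrite q_def -mulrA ltW// !mulr_gt0.
apply: mulr_ge0; last by apply: prodr_ge0 => i _; rewrite invr_ge0.
apply: mulr_ge0.
  by case: x.1.1; rewrite /= ?subr_ge0// ltW.
by case: x.1.2; rewrite /= ?subr_ge0.
Qed.

(** The first draw of the history is split off, so that the induction
    hypothesis applies to the run restarted from the state it leads to. *)
Lemma lyapunov_run_draws T s :
  \sum_(h : T.-tuple (draw m)) (\prod_(x <- h) draw_weight p q x)
                               * V (run_draws s h)
  <= (1 - gamma * mu) ^+ T * V s.
Proof.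
elim: T s => [|T IHT] s.
  rewrite (big_pred1 [tuple]) => [|h]; last exact/esym/eqP/tuple0.
  by rewrite big_nil expr0.
rewrite tuple_sum_recl.
under eq_bigr => x _ do
  under eq_bigr => h _ do rewrite /= big_cons -mulrA.
under eq_bigr do rewrite -mulr_sumr.
rewrite exprSr -mulrA.
apply: (le_trans (y := \sum_(x : draw m) draw_weight p q x *
   ((1 - gamma * mu) ^+ T * V (draw_step s x)))).
  apply: ler_sum => x _; apply: ler_wpM2l; last exact: IHT.
  exact: draw_weight_ge0.
under eq_bigr do rewrite mulrCA.
rewrite -mulr_sumr ler_wpM2l ?exprn_ge0 ?subr_ge0 ?rate_le1//.
exact: lyapunov_contraction.
Qed.
End Contraction.

(** * The law of the history *)

Section FiniteValued.
Context {R : realType} {disp : measure_display} {Omega : measurableType disp}.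
Variable P : probability Omega R.

Lemma expectation_finite_valued (A : finType) (X : Omega -> A) (g : A -> R) :
  (forall a, measurable (X @^-1` [set a])) -> (forall a, 0 <= g a) ->
  'E_P[fun omega => g (X omega)]%E
  = (\sum_a (g a)%:E * P (X @^-1` [set a]))%E.
Proof.
move=> mX g0.
have mI a : measurable_fun setT (EFin \o (\1_(X @^-1` [set a]) : Omega -> R)).
  exact/measurable_EFinP/measurable_indic.
rewrite unlock.
transitivity (\int[P]_w (\sum_a (g a)%:E * (\1_(X @^-1` [set a]) w)%:E))%E.
  apply: eq_integral => w _.
  rewrite (bigD1 (X w))//= big1 => [|a aX]; last first.
    by rewrite indicE memNset ?mule0// => /= /esym/eqP; apply/negP.
  by rewrite indicE mem_set// mule1 adde0.
rewrite ge0_integral_sum//=; last 2 first.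
- by move=> a; apply: (emeasurable_funM (measurable_cst (g a)%:E) (mI a)).
- by move=> a w _; rewrite mule_ge0// lee_fin.
apply: eq_bigr => a _; rewrite ge0_integralZl_EFin//.
  by rewrite integral_indic// setIT.
exact: mI.
Qed.

End FiniteValued.

Section History.
Context {R : realType} {disp : measure_display} {Omega : measurableType disp}.
Variable P : probability Omega R.
Context {n : nat} {m : 'I_n -> nat}.
Variables theta zeta : nat -> {RV P >-> bool}.
Variable j : forall i : 'I_n, nat -> Omega -> 'I_(m i).
Variables p q : R.
Hypothesis draws : algorithm_draws theta zeta j p q.

Definition draw_at (t : nat) (omega : Omega) : draw m :=
  (theta t omega, zeta t omega, [fprod i => j i t omega]).

Definition history (T : nat) (omega : Omega) : T.-tuple (draw m) :=
  [tuple draw_at t omega | t < T].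

Lemma RV_bool_law (X : {RV P >-> bool}) (r : R) b :
  P (X @^-1` [set true]) = r%:E ->
  P (X @^-1` [set b]) = (bernoulli_weight r b)%:E.
Proof.
case: b => // Xr.
have -> : X @^-1` [set false] = ~` (X @^-1` [set true]).
  by apply/seteqP; split => w /=; case: (X w).
by rewrite probability_setC ?Xr//; exact: measurable_funPTI.
Qed.

Section Cylinder.
Variables (T : nat) (h : T.-tuple (draw m)).

(** The elementary draws of the first T rounds, one for each event that enters
    the product rule of mutual independence. *)
Definition coordinate : finType := ('I_T + 'I_T + 'I_n * 'I_T)%type.

Definition coordinate_draw (k : coordinate) : @draw_index n :=
  match k with
  | inl (inl t) => ThetaDraw t
  | inl (inr t) => ZetaDraw t
  | inr (i, t) => SampleDraw i t
  end.

Definition coordinate_event (k : coordinate) : set Omega :=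
  match k with
  | inl (inl t) => theta t @^-1` [set (tnth h t).1.1]
  | inl (inr t) => zeta t @^-1` [set (tnth h t).1.2]
  | inr (i, t) => j i t @^-1` [set (tnth h t).2 i]
  end.

Lemma coordinate_draw_inj : injective coordinate_draw.
Proof.
move=> [[t|t]|[i t]] [[t'|t']|[i' t']]//= [].
- by move=> /val_inj ->.
- by move=> /val_inj ->.
- by move=> -> /val_inj ->.
Qed.

Lemma history_cylinder :
  history T @^-1` [set h]
  = \bigcap_(l : 'I_#|coordinate|) coordinate_event (enum_val l).
Proof.
apply/seteqP; split => [w /= wh l _|w /= wh].
  case: (enum_val l) => [[t|t]|[i t]] /=; rewrite -wh tnth_mktuple//=.
  by rewrite fprodE.
have ev k : coordinate_event k w.
  by have := wh (enum_rank k) I; rewrite enum_rankK.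
apply: eq_from_tnth => t; rewrite tnth_mktuple /draw_at.
have /= -> := ev (inl (inl t)); have /= -> := ev (inl (inr t)).
rewrite [RHS]surjective_pairing [in RHS](surjective_pairing (tnth h t).1).
congr (_, _); apply/fprodP => i; rewrite fprodE; exact: ev (inr (i, t)).
Qed.

Lemma measurable_history : measurable (history T @^-1` [set h]).
Proof.
have [mj _ _ _ _] := draws.
rewrite history_cylinder; apply: fin_bigcap_measurable => // l _.
by case: (enum_val l) => [[t|t]|[i t]] /=; [exact: measurable_funPTI..|].
Qed.

(** A history is an intersection of elementary events, one per coordinate, to
    which mutual independence applies; the product over coordinates regroups
    round by round. *)
Lemma history_law :
  P (history T @^-1` [set h]) = (\prod_(x <- h) draw_weight p q x)%:E.
Proof.
have [mj thetap zetaq jm indep] := draws.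
rewrite history_cylinder (indep _ (coordinate_draw \o enum_val)); first last.
- move=> l /=; case: (enum_val l) => [[t|t]|[i t]] /=.
  + by exists [set (tnth h t).1.1]; rewrite ?setTI.
  + by exists [set (tnth h t).1.2]; rewrite ?setTI.
  + by exists [set (tnth h t).2 i]; rewrite ?setTI.
- exact: inj_comp coordinate_draw_inj enum_val_inj.
pose w (k : coordinate) : R := match k with
  | inl (inl t) => bernoulli_weight p (tnth h t).1.1
  | inl (inr t) => bernoulli_weight q (tnth h t).1.2
  | inr (i, t) => (m i)%:R^-1
  end.
transitivity (\prod_(l < #|coordinate|) (w (enum_val l))%:E)%E.
  apply: eq_bigr => l _; case: (enum_val l) => [[t|t]|[i t]] /=.
  - exact: RV_bool_law.
  - exact: RV_bool_law.
  - exact: jm.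
rewrite prodEFin; congr EFin.
rewrite -(big_enum_val (A := coordinate) w)/= !big_sumType/=.
rewrite [X in _ * X = _](_ : _ = \prod_(i < n) \prod_(t < T) (m i)%:R^-1).
  by rewrite exchange_big/= -!big_split/= big_tuple.
by rewrite pair_bigA/=; apply: eq_bigr => -[].
Qed.

End Cylinder.

Lemma expectation_history T (g : T.-tuple (draw m) -> R) :
  (forall h, 0 <= g h) ->
  'E_P[fun omega => g (history T omega)]%E
  = (\sum_(h : T.-tuple (draw m))
       (\prod_(x <- h) draw_weight p q x) * g h)%:E.
Proof.
move=> g0; rewrite expectation_finite_valued//; last exact: measurable_history.
rewrite -sumEFin; apply: eq_bigr => h _.
by rewrite history_law -EFinM mulrC.
Qed.

Lemma expectation_comm_rounds T : 'E_P[comm_rounds theta T]%E = (p * T%:R)%:E.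
Proof.
have [_ thetap _ _ _] := draws.
have mtheta t b : measurable (theta t @^-1` [set b]) by exact: measurable_funPTI.
have Etheta (t : 'I_T) : (\int[P]_w ((theta t w)%:R : R)%:E = p%:E)%E.
  have := @expectation_finite_valued _ _ _ P _ (theta t) (fun b => b%:R)
    (mtheta t) (fun b => ler0n _ b).
  by rewrite unlock => ->; rewrite big_bool/= mul1e mul0e adde0 thetap.
rewrite unlock /comm_rounds; under eq_integral do rewrite -sumEFin.
rewrite ge0_integral_sum//=; last first.
  move=> t; apply/measurable_EFinP.
  have -> : (fun x => (theta t x)%:R : R) = \1_(theta t @^-1` [set true]).
    apply/funext => w; rewrite indicE; congr (_ _)%:R.
    by apply/idP/idP; rewrite inE.
  exact: measurable_indic.
under eq_bigr do rewrite Etheta.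
by rewrite sumEFin sumr_const card_ord mulr_natr.
Qed.

Lemma run_history (d : nat)
    (F : forall i : 'I_n, 'I_(m i) -> 'rV[R]_d -> 'rV[R]_d) (gamma : R) x0 T omega :
  run F gamma p (fun t => theta t omega) (fun t => zeta t omega)
    (fun i t => j i t omega) x0 T
  = run_draws F gamma p (init x0) (history T omega).
Proof.
have -> : history T omega = mkseq (draw_at^~ omega) T :> seq _.
  by rewrite /mkseq -val_enum_ord -map_comp.
elim: T => [//|T IHT]; rewrite mkseqS /run_draws foldl_rcons.
rewrite [LHS]/= IHT; congr step.
by apply: functional_extensionality_dep => i; rewrite fprodE.
Qed.

End History.

(** * From the contraction rate to the complexity *)

(** A crude form of 1/2 <= ln 2. *)
Lemma ln_ratio_ge {R : realType} (eps v : R) :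
  0 < eps -> eps <= v / 2 -> 2^-1 <= ln (v / eps).
Proof.
move=> eps0 epsv; have v0 : 0 < v by lra.
have r0 : 0 < eps / v by rewrite divr_gt0.
have r2 : eps / v <= 2^-1 by rewrite ler_pdivrMr// mulrC.
have := @le_ln1Dx R (eps / v - 1).
rewrite addrCA subrr addr0 => /(_ _)/wrap[|H]; first by lra.
have -> : v / eps = (eps / v)^-1 by rewrite invf_div.
by rewrite lnV ?posrE//; lra.
Qed.

Lemma geometric_decay_le {R : realType} (rate eps v : R) (T : nat) :
  rate <= 1 -> 0 < eps -> 0 < v -> ln (v / eps) <= rate * T%:R ->
  (1 - rate) ^+ T * v <= eps.
Proof.
move=> rate1 eps0 v0 lnT.
have rT : (1 - rate) ^+ T <= expR (- (rate * T%:R)).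
  rewrite -mulNr expRM_natr lerXn2r ?nnegrE ?expR_ge0 ?subr_ge0//.
  exact: expR_ge1Dx.
rewrite -ler_pdivlMr//; apply: le_trans rT _.
rewrite -[eps / v]lnK ?posrE ?divr_gt0// ler_expR.
by rewrite -invf_div lnV ?posrE ?divr_gt0// lerN2.
Qed.

(** Rounding 6 kappa L up costs at most 1, and 1 <= 2 kappa L since
    kappa L >= 1/2: this is where 8 = 6 + 2 comes from. *)
Lemma iteration_count {R : realType} (kappa L : R) : 1 <= kappa -> 2^-1 <= L ->
  exists T : nat, [/\ L <= (6 * kappa)^-1 * T%:R,
    T%:R <= 8 * kappa * L
    & Num.sqrt (6 * kappa)^-1 * T%:R <= 8 * Num.sqrt kappa * L].
Proof.
move=> k1 L2; have k0 : 0 < kappa by lra.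
pose T := (Num.trunc (6 * kappa * L)).+1.
have kL0 : 0 <= 6 * kappa * L by apply: mulr_ge0; lra.
have /andP[T_le T_gt] : (Num.trunc (6 * kappa * L))%:R <= 6 * kappa * L < T%:R.
  exact: truncn_itv.
have kL : 2^-1 <= kappa * L by rewrite (le_trans L2)// ler_peMl//; lra.
have T8 : T%:R <= 8 * kappa * L.
  by rewrite /T -natr1; lra.
exists T; split=> //.
  by rewrite mulrC ler_pdivlMr ?mulr_gt0// mulrC ltW.
have s0 : 0 < Num.sqrt kappa by rewrite sqrtr_gt0.
have ksq : kappa = Num.sqrt kappa ^+ 2 by rewrite sqr_sqrtr ?ltW.
have kle : Num.sqrt (6 * kappa)^-1 <= (Num.sqrt kappa)^-1.
  have k6 : 0 < 6 * kappa by lra.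
  rewrite sqrtrV ?(ltW k6)// lef_pV2 ?posrE ?sqrtr_gt0//.
  by rewrite ler_sqrt ?(ltW k6)//; lra.
have /le_trans : Num.sqrt (6 * kappa)^-1 * T%:R <=
    (Num.sqrt kappa)^-1 * (8 * kappa * L).
  by rewrite ler_pM ?sqrtr_ge0.
apply; rewrite {2}ksq le_eqVlt; apply/orP; left; apply/eqP.
by field; rewrite gt_eqF.
Qed.

Lemma lyapunov_ge0 {R : realType} {d n : nat} {m : 'I_n -> nat}
    (F : forall i : 'I_n, 'I_(m i) -> 'rV[R]_d -> 'rV[R]_d)
    (gamma p q : R) z s : 0 <= q -> 0 <= lyapunov F gamma p q z s.
Proof.
move=> q0; have sq_ge0 (g : 'I_n -> 'rV[R]_d) : 0 <= \sum_i l2norm (g i) ^+ 2.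
  by apply: sumr_ge0 => i _; exact: sqr_ge0.
apply: addr_ge0; first apply: addr_ge0 => //.
  by apply: mulr_ge0 => //; exact: sqr_ge0.
apply: mulr_ge0; last by apply: sumr_ge0 => i _; exact: mean_sq_dev_ge0.
by apply: mulr_ge0; [exact: divr_ge0|exact: sqr_ge0].
Qed.

Theorem theorem4p4 (R : realType) :
  exists2 c : R, 0 < c &
  forall (d n : nat) (m : 'I_n -> nat)
    (F : forall i : 'I_n, 'I_(m i) -> 'rV[R]_d -> 'rV[R]_d)
    (zstar : 'rV[R]_d) (mu ell : R),
  (0 < n)%N -> (forall i, (0 < m i)%N) ->
  unique (vip_solution (global_op F)) zstar ->
  0 < mu ->
  (forall i, quasi_strongly_monotone mu zstar (client_op F i)) ->
  0 < ell ->
  averaged_star_cocoercive F ell zstar ->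
  forall gamma p q : R,
  gamma = Num.min (1 / mu) (1 / (6 * ell)) ->
  p = Num.sqrt (gamma * mu) ->
  q = 2 * gamma * mu ->
  forall (disp : measure_display) (Omega : measurableType disp)
    (P : probability Omega R)
    (theta zeta : nat -> {RV P >-> bool})
    (j : forall i : 'I_n, nat -> Omega -> 'I_(m i)),
  algorithm_draws theta zeta j p q ->
  forall x0 : 'I_n -> 'rV[R]_d,
  let V (t : nat) (omega : Omega) : R :=
    lyapunov F gamma p q zstar
      (run F gamma p (fun t => theta t omega) (fun t => zeta t omega)
        (fun i t => j i t omega) x0 t) in
  let V0 : R := lyapunov F gamma p q zstar (init x0) in
  forall eps : R, 0 < eps <= V0 / 2 ->
  exists T : nat,
    [/\ ('E_P[V T] <= eps%:E)%E,
        T%:R <= c * (ell / mu) * ln (V0 / eps),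
        'E_P[comm_rounds theta T]%E = (p * T%:R)%:E
      & p * T%:R <= c * Num.sqrt (ell / mu) * ln (V0 / eps)].
Proof.
exists 8 => // d n m F z mu ell n0 m0 [zvip _] mu0 qsm ell0 coc gamma p q.
move=> gammaE pE qE disp Omega P theta zeta j draws x0 V V0 eps /andP[].
move=> eps0 epsV.
have z_sol : global_op F z = 0 by exact: vip_solution_zero zvip.
have V0_gt0 : 0 < V0 by lra.
(* if z were the only point of the space, V0 would vanish *)
have mu_ell : mu <= ell.
  case: (lerP mu ell) => // ell_mu.
  suff V00 : V0 = 0 by rewrite V00 ltxx in V0_gt0.
  have all_z u : u = z.
    apply/eqP; apply: contraLR ell_mu => uz; rewrite -leNgt.
    exact: (mu_le_ell m0 mu0 ell0 (qsm (Ordinal n0)) coc uz).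
  have norm0 (u : 'rV[R]_d) : l2norm u ^+ 2 = 0.
    by rewrite sqr_l2norm (all_z u) -(all_z 0) dotV0l.
  rewrite /V0 /lyapunov !big1 ?mulr0 ?addr0// => i _.
  by rewrite /mean_sq_dev big1 ?mulr0.
have gE : gamma = (6 * ell)^-1.
  by rewrite gammaE !div1r; apply/min_idPr; rewrite lef_pV2 ?posrE; lra.
have kappa1 : 1 <= ell / mu by rewrite ler_pdivlMr// mul1r.
have rateE : gamma * mu = (6 * (ell / mu))^-1.
  by rewrite gE; field; rewrite !gt_eqF.
have rate0 : 0 < gamma * mu by rewrite rateE invr_gt0; lra.
have rate6 : gamma * mu <= 6^-1 by rewrite rateE lef_pV2 ?posrE; lra.
have gamma0 : 0 < gamma by rewrite gE invr_gt0; lra.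
have q0 : 0 <= q by lra.
have [T [LT T8 pT8]] := iteration_count kappa1 (ln_ratio_ge eps0 epsV).
exists T; split=> //; last 2 first.
- exact: expectation_comm_rounds draws _.
- by rewrite pE rateE.
have -> : V T = fun omega => lyapunov F gamma p q z
    (run_draws F gamma p (init x0) (history theta zeta j T omega)).
  by apply/funext => omega; rewrite /V (run_history theta zeta).
rewrite (expectation_history draws (g := fun h =>
  lyapunov F gamma p q z (run_draws F gamma p (init x0) h))); last first.
  by move=> h; exact: lyapunov_ge0.
rewrite lee_fin.
have p0 : 0 < p by rewrite pE sqrtr_gt0.
have p2 : p ^+ 2 = gamma * mu by rewrite pE sqr_sqrtr// ltW.
have gamma_ell : 6 * ell * gamma <= 1.
  by rewrite gE mulfV// gt_eqF// mulr_gt0.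
have q1 : q <= 1 by lra.
apply: le_trans (lyapunov_run_draws n0 m0 z_sol mu0 gamma0 p0 qsm coc gamma_ell
  p2 qE q1 T (init x0)) _.
by apply: geometric_decay_le => //; [lra|rewrite rateE].
Qed.
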